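(* Let $(F,G)\in\mathcal H_{\mathbf d}[q\,;\,s]$ with $q\leqslant n+1$, $D=\max_i d_i$, and $\kappa_*=\kappa_*(F,G)$. For any positive number $r<\big(13D^{3/2}\kappa_*^2\big)^{-1}$ we have $\mathsf{Approx}(F,G,r)\subseteq\mathcal U_{\mathbb S}\big(S(F,G),3\kappa_*r\big)$.
   Context: $\mathcal H_{\mathbf d}[q]$: $q$-tuples of real homogeneous polynomials in $X_0,\dots,X_n$ of degrees $d_i$ with the Weyl inner product ($\langle h,h'\rangle=\sum_{|a|=d}\binom da^{-1}h_ah'_a$, summed over components); $\mathcal H_{\mathbf d}[q\,;\,s]$: pairs $(F,G)$ of a $q$-tuple and an $s$-tuple. $S(F,G)=\{x\in\mathbb S^n: f(x)=0\ \forall f\in F,\ g(x)\geq0\ \forall g\in G\}$; $\mathcal U_{\mathbb S}(A,r)=\{x\in\mathbb S^n:d_{\mathbb S}(x,A)<r\}$ with $d_{\mathbb S}$ geodesic distance; $\mathsf{Approx}(F,G,r)=\{x\in\mathbb S^n:|f(x)|<\|f\|r\ \forall f\in F,\ g(x)>-\|g\|r\ \forall g\in G\}$. For $x\in\mathbb S^n$: $T_x=\{x\}^\perp$, $\Delta=\mathrm{diag}(\sqrt{d_i})$, $\mu_{\mathrm{proj}}(F,x)=\|F\|\,\|(\mathrm DF(x)|_{T_x})^\dagger\Delta\|$ if $\mathrm DF(x)|_{T_x}$ surjective, else $\infty$; $\kappa(F,x)=(\mu_{\mathrm{proj}}(F,x)^{-2}+\|F(x)\|^2/\|F\|^2)^{-1/2}$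 ($\infty^{-1}=0$, $0^{-1}=\infty$, $\kappa(0,x)=\infty$); $\kappa(F)=\max_x\kappa(F,x)$; $\kappa_*(F,G)=\max\{\kappa(F^L):L\subseteq G,\ q+|L|\leq n+1\}$ where $F^L$ is $F$ with the polynomials of subtuple $L$ appended. *)

(* Defs.v *)
From HB Require Import structures.
From mathcomp Require Import all_boot all_order all_algebra.
From mathcomp Require Import all_classical all_reals all_analysis.
Set Implicit Arguments. Unset Strict Implicit. Unset Printing Implicit Defensive.
Import Order.TTheory GRing.Theory Num.Theory.
Import numFieldNormedType.Exports.
Local Open Scope classical_set_scope.
Local Open Scope ring_scope.

Section Defs.
Variable R : realType.

Definition mono (n d : nat) : finType :=
  {a : {ffun 'I_n.+1 -> 'I_d.+1} | (\sum_i (a i : nat))%N == d}.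

(* A real homogeneous polynomial in X_0..X_n of degree hdeg, given by its
   coefficients h_a, |a| = hdeg. *)
Record hpoly (n : nat) := HPoly { hdeg : nat; hcoef : {ffun mono n hdeg -> R} }.

Definition hpoly0 (n : nat) : hpoly n := @HPoly n 0 [ffun => 0].

Variable n : nat.
Implicit Types (h f g : hpoly n) (F G : seq (hpoly n)) (x y : 'cV[R]_n.+1).

Definition heval h x : R :=
  \sum_(a : mono n (hdeg h)) hcoef h a * \prod_i x i 0 ^+ (val a i).

Definition hpartial h (j : 'I_n.+1) x : R :=
  \sum_(a : mono n (hdeg h)) hcoef h a * (val a j : nat)%:R *
     \prod_i (if i == j then x i 0 ^+ (val a i).-1 else x i 0 ^+ val a i).

Definition multinom (d : nat) (a : mono n d) : R :=
  (d`!)%:R / \prod_i ((val a i : nat)`!)%:R.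

Definition wnorm2 h : R :=
  \sum_(a : mono n (hdeg h)) (multinom a)^-1 * (hcoef h a) ^+ 2.
Definition wnorm h : R := Num.sqrt (wnorm2 h).
Definition tnorm F : R := Num.sqrt (\sum_(f <- F) wnorm2 f).

Definition vnorm (k : nat) (v : 'cV[R]_k) : R := Num.sqrt (\sum_i v i 0 ^+ 2).
Definition sphere : set 'cV[R]_n.+1 := [set x | \sum_i x i 0 ^+ 2 = 1].
Definition dS x y : R := acos (\sum_i x i 0 * y i 0).
Definition dSset x (A : set 'cV[R]_n.+1) : \bar R :=
  ereal_inf [set (dS x a)%:E | a in A].
Definition USph (A : set 'cV[R]_n.+1) (rho : \bar R) : set 'cV[R]_n.+1 :=
  [set x | sphere x /\ (dSset x A < rho)%E].

Definition opnorm (m k : nat) (B : 'M[R]_(m, k)) : R :=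
  sup [set vnorm (B *m v) | v in [set v : 'cV[R]_k | vnorm v = 1]].

Definition tevalF F x : 'cV[R]_(size F) := \col_i heval (nth (hpoly0 n) F i) x.
Definition jac F x : 'M[R]_(size F, n.+1) :=
  \matrix_(i, j) hpartial (nth (hpoly0 n) F i) j x.

Definition DFsurj F x : Prop :=
  forall w : 'cV[R]_(size F), exists u : 'cV[R]_n.+1,
    x^T *m u = 0 /\ jac F x *m u = w.

(* (DF(x)|_{T_x})^dagger, as a map R^q -> T_x (subset of R^{n+1}):
   with M = DF(x) P_x (P_x orthogonal projection on T_x), of full row rank,
   the Moore-Penrose pseudoinverse is M^T (M M^T)^{-1}. *)
Definition projT x : 'M[R]_n.+1 := 1%:M - x *m x^T.
Definition pinvT F x : 'M[R]_(n.+1, size F) :=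
  let M := jac F x *m projT x in (M^T *m invmx (M *m M^T)).
Definition Delta F : 'M[R]_(size F) :=
  diag_mx (\row_i Num.sqrt (hdeg (nth (hpoly0 n) F i))%:R).

Definition mu_proj F x : \bar R :=
  if `[< DFsurj F x >] then (tnorm F * opnorm (pinvT F x *m Delta F))%:E
  else +oo%E.

Definition einv (e : \bar R) : \bar R :=
  match e with
  | EFin t => if t == 0 then +oo%E else (t^-1)%:E
  | +oo%E => 0%E
  | -oo%E => 0%E
  end.
Definition esqrt (e : \bar R) : \bar R :=
  match e with
  | EFin t => (Num.sqrt t)%:E
  | +oo%E => +oo%E
  | -oo%E => -oo%E
  end.

Definition kappa_x F x : \bar R :=
  if tnorm F == 0 then +oo%E
  else einv (esqrt (einv (mu_proj F x * mu_proj F x)%E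
                    + ((vnorm (tevalF F x)) ^+ 2 / (tnorm F) ^+ 2)%:E)%E).

Definition kappa F : \bar R := ereal_sup [set kappa_x F x | x in sphere].

Definition appendL F G (L : {set 'I_(size G)}) : seq (hpoly n) :=
  F ++ [seq nth (hpoly0 n) G (val i) | i <- enum L].

Arguments appendL : clear implicits.

Definition kappa_star F G : \bar R :=
  \big[Order.max/-oo%E]_(L : {set 'I_(size G)} | (size F + #|L| <= n.+1)%N)
     kappa (appendL F G L).

Definition SFG F G : set 'cV[R]_n.+1 :=
  [set x | sphere x /\
     (forall i : 'I_(size F), heval (nth (hpoly0 n) F i) x = 0) /\
     (forall j : 'I_(size G), 0 <= heval (nth (hpoly0 n) G j) x)].

Definition Approx F G (r : R) : set 'cV[R]_n.+1 :=
  [set x | sphere x /\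
     (forall i : 'I_(size F),
        `|heval (nth (hpoly0 n) F i) x| < wnorm (nth (hpoly0 n) F i) * r) /\
     (forall j : 'I_(size G),
        - (wnorm (nth (hpoly0 n) G j) * r) < heval (nth (hpoly0 n) G j) x)].

Definition maxdeg F G : nat := \max_(f <- F ++ G) hdeg f.

End Defs.

(* Main.v *)
Require Import Defs.
From HB Require Import structures.
From mathcomp Require Import all_boot all_order all_algebra.
From mathcomp Require Import all_classical all_reals all_analysis.
From mathcomp Require Import ring lra.
Import Order.TTheory GRing.Theory Num.Theory.
Import numFieldNormedType.Exports.
Local Open Scope classical_set_scope.
Local Open Scope ring_scope.

(* A variational argument. Let [k = kappa_star F G], and let [violation y] be
   the least [t >= 0] such that [|f y| <= t ||f||] for [f] in [F] and
   [- g y <= t ||g||] for [g] in [G]; it vanishes on the sphere exactly on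
   [S(F,G)], and is at most [r] on [Approx]. For [x] in [Approx], minimise
   [violation y + |y - x| / (2 k)] over the sphere, and suppose that
   [t = violation y > 0] at a minimiser [y]. Let [L] be the inequalities that
   attain [t] at [y]. All members of [F^L] are smaller than [t] times their norm,
   so the bound on [kappa] leaves essentially [mu_proj(F^L, y) <= k]; in
   particular [F^L] has at most [n] members, and the Newton direction
   [u = - DF^L(y)^dagger F^L(y)], tangent to the sphere, satisfies
   [|u| <= 6/5 k t]. Moving along [u] and rescaling back to the sphere decreases
   the violation at rate close to [t], hence the minimised sum: a contradiction.
   So [y] is a solution with [|y - x| <= 2 k r], and [k r] is small because
   [k >= 1/2], which is checked at the first basis vector, where the values and
   derivatives of a polynomial are single coefficients. *)

(** * Euclidean norms and operator norms *)

(** Lagrange's identity: the double sum of the squares [(a i * b j - a j * b i) ^+ 2] equals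
    [2 * (A * B - C ^+ 2)]. *)
Lemma cauchy_schwarz_sum {R : realType} {I : finType} (a b : I -> R) :
  (\sum_i a i * b i) ^+ 2 <= (\sum_i a i ^+ 2) * (\sum_i b i ^+ 2).
Proof.
set A := \sum_i a i ^+ 2; set B := \sum_i b i ^+ 2; set C := \sum_i a i * b i.
have : 0 <= \sum_i \sum_j (a i * b j - a j * b i) ^+ 2.
  by apply: sumr_ge0 => i _; apply: sumr_ge0 => j _; exact: sqr_ge0.
have E i : \sum_j (a i * b j - a j * b i) ^+ 2 =
    a i ^+ 2 * B - 2 * C * (a i * b i) + A * b i ^+ 2.
  rewrite /A /B /C mulr_sumr mulr_sumr !mulr_suml -sumrB -big_split /=.
  by apply: eq_bigr => j _; ring.
rewrite (eq_bigr _ (fun i _ => E i)) big_split /= sumrB -!mulr_suml -!mulr_sumr.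
rewrite -/A -/B -/C => h; lra.
Qed.

Section EuclideanNorm.
Context {R : realType}.

Lemma sum_sqr_ge0 {I : finType} (a : I -> R) : 0 <= \sum_i a i ^+ 2.
Proof. by apply: sumr_ge0 => i _; exact: sqr_ge0. Qed.

Lemma vnorm_ge0 {k} (v : 'cV[R]_k) : 0 <= vnorm v.
Proof. exact: sqrtr_ge0. Qed.

Lemma sqr_vnorm {k} (v : 'cV[R]_k) : vnorm v ^+ 2 = \sum_i v i 0 ^+ 2.
Proof. by rewrite sqr_sqrtr// sum_sqr_ge0. Qed.

Lemma vnorm_le {k l} (v : 'cV[R]_k) (w : 'cV[R]_l) :
  (vnorm v <= vnorm w) = (\sum_i v i 0 ^+ 2 <= \sum_i w i 0 ^+ 2).
Proof. by rewrite ler_sqrt// sum_sqr_ge0. Qed.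

Lemma vnormZ {k} (a : R) (v : 'cV[R]_k) : vnorm (a *: v) = `|a| * vnorm v.
Proof.
rewrite /vnorm -sqrtr_sqr -sqrtrM ?sqr_ge0// mulr_sumr.
by congr Num.sqrt; apply: eq_bigr => i _; rewrite mxE exprMn.
Qed.

Lemma vnorm0 {k} : vnorm (0 : 'cV[R]_k) = 0.
Proof. by rewrite -(scale0r 0) vnormZ normr0 mul0r. Qed.

Lemma vnorm_eq0 {k} (v : 'cV[R]_k) : vnorm v = 0 -> v = 0.
Proof.
move=> v0; have /eqP := sqr_vnorm v; rewrite v0 expr0n/= eq_sym.
rewrite psumr_eq0 => [/allP h|i _]; last exact: sqr_ge0.
apply/matrixP => i j; rewrite !ord1 mxE.
by have := h i (mem_index_enum _); rewrite /= sqrf_eq0 => /eqP.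
Qed.

Lemma dot_le_vnorm {k} (v w : 'cV[R]_k) :
  \sum_i v i 0 * w i 0 <= vnorm v * vnorm w.
Proof.
apply: le_trans (ler_norm _) _; rewrite -sqrtr_sqr /vnorm -sqrtrM ?sum_sqr_ge0//.
by rewrite ler_sqrt ?cauchy_schwarz_sum// mulr_ge0// sum_sqr_ge0.
Qed.

Lemma vnormD {k} (v w : 'cV[R]_k) : vnorm (v + w) <= vnorm v + vnorm w.
Proof.
rewrite -ler_sqr ?nnegrE ?addr_ge0 ?vnorm_ge0// sqrrD !sqr_vnorm.
rewrite (eq_bigr (fun i => v i 0 ^+ 2 + (v i 0 * w i 0) *+ 2 + w i 0 ^+ 2)); last first.
  by move=> i _; rewrite mxE sqrrD.
by rewrite !big_split/= -mulr2n lerD2r lerD2l lerMn2r dot_le_vnorm.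
Qed.

(** The Frobenius norm bounds the set whose supremum is [opnorm B], so that this supremum is a
    genuine upper bound. *)
Lemma vnorm_mulmx_le {m k} (B : 'M[R]_(m, k)) (v : 'cV[R]_k) :
  vnorm (B *m v) <= Num.sqrt (\sum_i \sum_j B i j ^+ 2) * vnorm v.
Proof.
have B0 : 0 <= \sum_i \sum_j B i j ^+ 2.
  by apply: sumr_ge0 => i _; exact: sum_sqr_ge0.
rewrite /vnorm -sqrtrM// ler_sqrt ?mulr_ge0 ?sum_sqr_ge0// mulr_suml.
by apply: ler_sum => i _; rewrite mxE cauchy_schwarz_sum.
Qed.

Lemma opnorm_unit {m k} (B : 'M[R]_(m, k)) (v : 'cV[R]_k) :
  vnorm v = 1 -> vnorm (B *m v) <= opnorm B.
Proof.
move=> v1; apply: ub_le_sup; last by exists v.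
exists (Num.sqrt (\sum_i \sum_j B i j ^+ 2)) => _ [w /= w1 <-].
by have := vnorm_mulmx_le B w; rewrite w1 mulr1.
Qed.

Lemma vnorm_mulmx_opnorm {m k} (B : 'M[R]_(m, k)) (v : 'cV[R]_k) :
  vnorm (B *m v) <= opnorm B * vnorm v.
Proof.
have [v0|v0] := eqVneq (vnorm v) 0.
  by rewrite (vnorm_eq0 _ v0) mulmx0 !vnorm0 mulr0.
have vp : 0 < vnorm v by rewrite lt_def v0 vnorm_ge0.
have w1 : vnorm ((vnorm v)^-1 *: v) = 1.
  by rewrite vnormZ gtr0_norm ?invr_gt0// mulVf.
have := opnorm_unit B _ w1.
by rewrite -scalemxAr vnormZ gtr0_norm ?invr_gt0// mulrC ler_pdivrMr.
Qed.

Lemma mulmx_tr_self_eq0 {k} (v : 'rV[R]_k) : v *m v^T = 0 -> v = 0.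
Proof.
move=> /matrixP/(_ 0 0); rewrite !mxE => v0.
apply: trmx_inj; rewrite trmx0; apply: vnorm_eq0; rewrite /vnorm.
rewrite -[RHS]sqrtr0 -[in RHS]v0; congr Num.sqrt.
by apply: eq_bigr => i _; rewrite !mxE expr2.
Qed.

(** If [v *m M *m M^T = 0], then [v *m M] is orthogonal to itself, hence zero, and a right inverse
    of [M] gives [v = 0]. This makes the [invmx] inside [pinvT] a true inverse. *)
Lemma gram_unitmx {m k} (M : 'M[R]_(m, k)) :
  row_free M -> M *m M^T \in unitmx.
Proof.
move=> Mf; rewrite -row_free_unit -kermx_eq0; apply/rowV0P => v.
move=> /sub_kermxP vG.
have vM : v *m M = 0.
  by apply: mulmx_tr_self_eq0; rewrite trmx_mul mulmxA -(mulmxA v) vG mul0mx.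
have [B MB] := row_freeP Mf.
by rewrite -(mulmx1 v) -MB mulmxA vM mul0mx.
Qed.

End EuclideanNorm.

(** * Homogeneous polynomials along lines *)

Section HomogeneousPolynomials.
Context {R : realType} {n : nat}.
Implicit Types (h : hpoly R n) (y u : 'cV[R]_n.+1).

Definition eunit : 'cV[R]_n.+1 := \col_i (i == ord0)%:R.

Lemma hevalZ h (a : R) y : heval h (a *: y) = a ^+ hdeg h * heval h y.
Proof.
rewrite /heval mulr_sumr; apply: eq_bigr => b _.
rewrite (eq_bigr (fun i => a ^+ val b i * y i 0 ^+ val b i)); last first.
  by move=> i _; rewrite mxE exprMn.
rewrite big_split /= prodrXr.
by rewrite (eqP (valP b)) mulrCA.
Qed.

Lemma continuous_heval h : continuous (heval h).
Proof.
apply: (continuous_big (op := +%R)).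
  by move=> z; apply: cvgD; [exact: cvg_fst|exact: cvg_snd].
move=> a _ y; apply: continuousM; first exact: cst_continuous.
suff : continuous (fun z : 'cV[R]_n.+1 => \prod_i z i 0 ^+ val a i) by apply.
have mulc : continuous (fun z : R * R => z.1 * z.2).
  by move=> z; apply: cvgM; [exact: cvg_fst|exact: cvg_snd].
apply: (@continuous_big R _ _ _ _ mulc _ _ (fun i (z : 'cV[R]_n.+1) => z i 0 ^+ val a i)).
move=> i _ z.
apply: (@continuous_comp _ _ _ (fun M : 'cV[R]_n.+1 => M i 0) (fun t : R => t ^+ _)).
  exact: coord_continuous.
exact: exprn_continuous.
Qed.

Lemma deriv_prod {I : eqType} (r : seq I) (p : I -> {poly R}) : uniq r ->
  (\prod_(i <- r) p i)^`() =
  \sum_(j <- r) \prod_(i <- r) (if i == j then (p i)^`() else p i).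
Proof.
elim: r => [|a r IH] /=; first by rewrite !big_nil derivC.
case/andP => ar ur; rewrite !big_cons derivM eqxx IH//.
congr (_ + _).
  congr (_ * _); apply: eq_big_seq => i ir.
  by case: eqP => // ia; rewrite -ia ir in ar.
rewrite mulr_sumr; apply: eq_big_seq => j jr.
rewrite big_cons; case: eqP => // aj.
by rewrite aj jr in ar.
Qed.

(** Restricting to a line yields a univariate polynomial, so that differentiation becomes formal and
    [hpartial] can be read off at [0]. *)
Definition line_poly h y u : {poly R} :=
  \sum_(a : mono n (hdeg h))
     (hcoef h a)%:P * \prod_i ((y i 0)%:P + (u i 0)%:P * 'X) ^+ val a i.

Lemma line_polyE h y u (s : R) :
  (line_poly h y u).[s] = heval h (y + s *: u).
Proof.
rewrite /line_poly horner_sum; apply: eq_bigr => a _.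
rewrite hornerM hornerC horner_prod; congr (_ * _).
by apply: eq_bigr => i _; rewrite !hornerE !mxE mulrC.
Qed.

Lemma line_poly_deriv h y u :
  (line_poly h y u)^`().[0] = \sum_j hpartial h j y * u j 0.
Proof.
rewrite /line_poly raddf_sum horner_sum /hpartial.
under [RHS]eq_bigr do rewrite mulr_suml.
rewrite exchange_big /=; apply: eq_bigr => a _.
rewrite derivM derivC mul0r add0r hornerM hornerC deriv_prod ?index_enum_uniq//.
rewrite horner_sum mulr_sumr; apply: eq_bigr => j _.
rewrite horner_prod (bigD1 j)//= [in RHS](bigD1 j)//= eqxx.
rewrite (eq_bigr (fun i => if i == j then y i 0 ^+ (val a i).-1 else y i 0 ^+ val a i)); last first.
  by move=> i /negPf ->; rewrite !hornerE.
rewrite deriv_exp !hornerE !poly.derivE !hornerE hornerMn !hornerE /= -mulr_natr; ring.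
Qed.

(** The first-order Taylor remainder [q] vanishes at [0] together with its derivative. Hence [q] is
    ['X] times a polynomial [q1] with [q1.[0] = 0], which is at most [e] in absolute value near [0]
    by continuity. *)
Lemma heval_directional_derivative h y u (e : R) : 0 < e ->
  \forall s \near (0:R)^'+,
    `|heval h (y + s *: u) - heval h y - s * \sum_j hpartial h j y * u j 0|
      <= e * s.
Proof.
move=> e0; set p := line_poly h y u; set q := p - p.[0]%:P - p^`().[0] *: 'X.
have q0 : root q 0 by rewrite /root /q !hornerE subrr subr0.
have [q1 q1E] := factor_theorem _ _ q0.
have q10 : q1.[0] = 0.
  have : q^`().[0] = 0 by rewrite /q !poly.derivE !hornerE subr0 subrr.
  by rewrite q1E !poly.derivE !hornerE oppr0 mulr0 add0r.
have /cvgrPdist_le/(_ e e0) q1c : q1.[s] @[s --> 0] --> (0 : R).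
  by rewrite -[X in _ --> X]q10; exact: continuous_horner.
near=> s.
have s0 : 0 < s by near: s; exact: nbhs_right_gt.
rewrite -!line_polyE -line_poly_deriv -/p.
have -> : heval h y = p.[0] by rewrite line_polyE scale0r addr0.
have -> : p.[s] - p.[0] - s * p^`().[0] = q1.[s] * s.
  have := congr1 (fun r : {poly R} => r.[s]) q1E.
  by rewrite /q !hornerE subr0 => <-; rewrite mulrC.
rewrite normrM (gtr0_norm s0) ler_pM2r//.
have : `|0 - q1.[s]| <= e by near: s; exact: cvg_at_right_filter q1c.
by rewrite sub0r normrN.
Unshelve. all: by end_near. Qed.

End HomogeneousPolynomials.

(** * Values and derivatives at the first basis vector *)

Section FirstBasisVector.
Context {R : realType} {n : nat}.
Implicit Types (h : hpoly R n) (u : 'cV[R]_n.+1).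

Lemma multinom_gt0 {d} (a : mono n d) : 0 < multinom R a.
Proof.
by rewrite divr_gt0 ?ltr0n ?fact_gt0// prodr_gt0// => i _; rewrite ltr0n fact_gt0.
Qed.

Lemma wnorm2_ge0 h : 0 <= wnorm2 h.
Proof.
by apply: sumr_ge0 => a _; rewrite mulr_ge0 ?sqr_ge0// invr_ge0 ltW ?multinom_gt0.
Qed.

Lemma mono_split {d} (a : mono n d) :
  (val a ord0 + \sum_(i < n.+1 | i != ord0) val a i = d)%N.
Proof. by rewrite -[RHS](eqP (valP a)) [RHS](bigD1 ord0). Qed.

(** The total degree is fixed, so the exponent of the first variable is determined by the others. *)
Lemma mono_eq {d} (a b : mono n d) :
  (forall i, i != ord0 -> val a i = val b i :> nat) -> a = b.
Proof.
move=> ab; apply/val_inj/ffunP => i; apply/val_inj => /=.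
have [->|/ab//] := eqVneq i ord0.
apply/eqP; rewrite -(eqn_add2r (\sum_(i < n.+1 | i != ord0) val a i)).
by rewrite mono_split (eq_bigr _ ab) mono_split.
Qed.

Lemma multinom_small {d} (a : mono n d) :
  (forall i, i != ord0 -> val a i <= 1)%N ->
  multinom R a = (d`!)%:R / ((val a ord0 : nat)`!)%:R.
Proof.
move=> a1; rewrite /multinom (bigD1 ord0)//= big1 ?mulr1// => i i0.
by case: (nat_of_ord (val a i)) (a1 i i0) => [|[]].
Qed.

(** The Weyl norm weights coefficients by inverse multinomials, so a linear form in the coefficients
    is measured by the dual weights [multinom R a]. Values and derivatives at a point are such
    forms. *)
Lemma weighted_cauchy_schwarz h (b : mono n (hdeg h) -> R) (C : R) :
  \sum_a multinom R a * b a ^+ 2 <= C ->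
  (\sum_a hcoef h a * b a) ^+ 2 <= C * wnorm2 h.
Proof.
move=> bC; have m0 (a : mono n (hdeg h)) := multinom_gt0 a.
pose s (a : mono n (hdeg h)) := Num.sqrt (multinom R a).
have s0 a : s a != 0 by rewrite gt_eqF ?sqrtr_gt0.
have s2 a : s a ^+ 2 = multinom R a by rewrite sqr_sqrtr ?ltW.
rewrite (eq_bigr (fun a => (s a * b a) * ((s a)^-1 * hcoef h a))); last first.
  by move=> a _; field; exact: s0.
apply: le_trans (cauchy_schwarz_sum _ _) _.
rewrite (eq_bigr (fun a => multinom R a * b a ^+ 2)); last first.
  by move=> a _; rewrite exprMn s2.
rewrite [X in _ * X](eq_bigr (fun a => (multinom R a)^-1 * hcoef h a ^+ 2)); last first.
  by move=> a _; rewrite exprMn exprVn s2.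
by rewrite ler_wpM2r ?wnorm2_ge0.
Qed.

Lemma eunit_prod (a : 'I_n.+1 -> nat) :
  \prod_i (@eunit R n) i 0 ^+ a i = [forall i, (i == ord0) || (a i == 0)%N]%:R.
Proof.
case: forallP => [a0|/forallP/forallPn[i]].
  rewrite big1// => i _; have := a0 i; rewrite mxE.
  by case: eqP => /= [|_ /eqP->]; rewrite ?expr1n.
rewrite negb_or => /andP[i0 ai]; rewrite (bigD1 i)//= mxE (negPf i0) expr0n.
by rewrite (negPf ai) mul0r.
Qed.

Lemma sum_unique_le1 {I : finType} (P : pred I) :
  (forall a b, P a -> P b -> a = b) -> \sum_a (P a)%:R <= 1 :> R.
Proof.
move=> uP; case: (pickP P) => [a Pa|none].
  rewrite (bigD1 a)//= Pa big1 ?addr0// => b ba.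
  by case Pb : (P b) => //; rewrite (uP _ _ Pb Pa) eqxx in ba.
by rewrite big1// => a _; rewrite none.
Qed.

(** Only the pure power of the first variable survives at [eunit], and its multinomial coefficient
    is 1. *)
Lemma heval_eunit_le h : heval h (@eunit R n) ^+ 2 <= wnorm2 h.
Proof.
rewrite -[leRHS]mul1r; apply: weighted_cauchy_schwarz.
pose P (a : mono n (hdeg h)) := [forall i, (i == ord0) || (val a i == 0 :> nat)].
have Pi a i : P a -> i != ord0 -> val a i = 0 :> nat.
  by move=> /forallP/(_ i) + i0; rewrite (negPf i0) => /eqP.
rewrite (eq_bigr (fun a => (P a)%:R)).
  apply: sum_unique_le1 => a b Pa Pb; apply: mono_eq => i i0.
  by rewrite (Pi a)// (Pi b).
move=> a _; rewrite eunit_prod -/(P a).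
case Pa : (P a); last by rewrite expr0n mulr0.
rewrite expr1n mulr1 multinom_small => [|i i0]; last by rewrite (Pi a).
have := mono_split a; rewrite big1 => [|i i0]; last by rewrite (Pi a).
by rewrite addn0 => ->; rewrite divff// pnatr_eq0 -lt0n fact_gt0.
Qed.

(** For [u] orthogonal to [eunit], only the monomials $X_0^{d-1}X_j$ with $j\neq 0$ contribute. Each
    has multinomial coefficient $d$, which is where the factor [hdeg h] comes from. *)
Lemma directional_derivative_eunit_le h u : u ord0 0 = 0 ->
  (\sum_j hpartial h j (@eunit R n) * u j 0) ^+ 2
    <= (hdeg h)%:R * (\sum_j u j 0 ^+ 2) * wnorm2 h.
Proof.
move=> u0.
(* [E j a] says that [a] is the exponent of $X_0^{d-1}X_j$ with $j\neq0$. *)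
pose E (j : 'I_n.+1) (a : mono n (hdeg h)) := [&& j != ord0, val a j == 1 :> nat &
  [forall i, [|| i == ord0, i == j | val a i == 0 :> nat]]].
have Ei j a (i : 'I_n.+1) : E j a -> i != ord0 -> val a i = (i == j) :> nat.
  case/and3P => j0 /eqP aj /forallP/(_ i) + i0; rewrite (negPf i0)/=.
  by case: eqP => [->|_ /= /eqP].
have pE j (a : mono n (hdeg h)) : ((val a j : nat)%:R * \prod_i (if i == j then (@eunit R n) i 0 ^+ (val a i).-1
     else (@eunit R n) i 0 ^+ val a i)) * u j 0 = (E j a)%:R * u j 0.
  have [->|j0] := eqVneq j ord0; first by rewrite u0 !mulr0.
  congr (_ * _).
  rewrite (eq_bigr (fun i => (@eunit R n) i 0 ^+ (if i == j then (val a i).-1 else val a i))); last first.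
    by move=> i _; case: ifP.
  rewrite eunit_prod /E j0 /=.
  have [aj|aj] := eqVneq (nat_of_ord (val a j)) 1%N.
    rewrite aj mul1r /=; congr (nat_of_bool _)%:R; apply: eq_forallb => i.
    by case: (eqVneq i j) => [->|//]; rewrite aj.
  rewrite /=.
  have [->|aj0] := eqVneq (nat_of_ord (val a j)) 0%N; first by rewrite mul0r.
  rewrite (_ : [forall _, _] = false) ?mulr0//; apply/negbTE/forallPn; exists j.
  by rewrite eqxx (negPf j0)/=; case: (nat_of_ord _) aj aj0 => [|[]].
pose b a := \sum_j (E j a)%:R * u j 0.
have -> : \sum_j hpartial h j (@eunit R n) * u j 0 = \sum_a hcoef h a * b a.
  rewrite /hpartial; under eq_bigr do rewrite mulr_suml.
  rewrite exchange_big; apply: eq_bigr => a _; rewrite /b mulr_sumr.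
  by apply: eq_bigr => j _; rewrite -pE !mulrA.
apply: weighted_cauchy_schwarz.
(* A given [a] satisfies [E j a] for at most one [j], so [b a] is a single coordinate of [u], or
   zero. *)
have bE a : multinom R a * b a ^+ 2 <= (hdeg h)%:R * \sum_j (E j a)%:R * u j 0 ^+ 2.
  case: (pickP (E^~ a)) => [j Ej|none]; last first.
    rewrite /b big1 => [|j _]; last by rewrite none mul0r.
    rewrite expr0n mulr0 mulr_ge0// sumr_ge0// => j _.
    by rewrite mulr_ge0 ?sqr_ge0.
  have uj i : i != j -> E i a = false.
    move=> ij; apply/negbTE/negP => /and3P[i0 /eqP ai _].
    by have := Ei _ _ _ Ej i0; rewrite (negPf ij) ai.
  have j0 : j != ord0 by case/and3P : Ej.
  have -> : b a = u j 0.
    rewrite /b (bigD1 j)//= Ej mul1r big1 ?addr0// => i ij.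
    by rewrite uj// mul0r.
  rewrite (bigD1 j)//= Ej mul1r big1 ?addr0 => [|i ij]; last by rewrite uj// mul0r.
  rewrite multinom_small => [|i i0]; last by rewrite (Ei j) ?leq_b1.
  have := mono_split a; rewrite (bigD1 j)//= (Ei j a j Ej j0) eqxx.
  rewrite big1 => [|i /andP[i0 /negPf ij]]; last by rewrite (Ei j a i Ej i0) ij.
  rewrite addn0 addn1; move: (nat_of_ord _) => m <-; rewrite factS natrM mulfK ?lexx ?pnatr_eq0 -?lt0n ?fact_gt0//.
apply: le_trans (ler_sum _ (fun a _ => bE a)) _.
rewrite -mulr_sumr ler_wpM2l// exchange_big/=; apply: ler_sum => j _.
rewrite -mulr_suml ler_piMl ?sqr_ge0//; apply: sum_unique_le1 => a c Ea Ec.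
by apply: mono_eq => i i0; rewrite (Ei j a)// (Ei j c).
Qed.

End FirstBasisVector.

(** * The condition number *)

Section ConditionNumber.
Context {R : realType} {n : nat}.
Implicit Types (H : seq (hpoly R n)) (y u : 'cV[R]_n.+1).

Local Notation nthp := (nth (hpoly0 R n)).

Lemma trmx_projT y : (projT y)^T = projT y.
Proof. by rewrite /projT linearB/= trmx1 trmx_mul trmxK. Qed.

Lemma sphere_dot y : sphere y -> y^T *m y = 1%:M.
Proof.
move=> y1; apply/matrixP => i j; rewrite !ord1 !mxE -[RHS]y1.
by apply: eq_bigr => k _; rewrite !mxE.
Qed.

Lemma tr_mul_projT y : sphere y -> y^T *m projT y = 0.
Proof.
by move=> /sphere_dot y1; rewrite mulmxBr mulmx1 mulmxA y1 mul1mx subrr.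
Qed.

Lemma projT_tangent y {k} (u : 'M[R]_(n.+1, k)) : y^T *m u = 0 -> projT y *m u = u.
Proof. by move=> yu; rewrite mulmxBl mul1mx -mulmxA yu mulmx0 subr0. Qed.

Lemma projT_idem y : sphere y -> projT y *m projT y = projT y.
Proof. by move=> y1; rewrite projT_tangent// tr_mul_projT. Qed.

(** The radial direction [y] lies in the kernel. This is what limits a tuple with surjective
    tangential derivative to [n] members. *)
Lemma rank_projT y : sphere y -> (\rank (projT y) <= n)%N.
Proof.
move=> y1; have : (y^T <= kermx (projT y))%MS by apply/sub_kermxP; exact: tr_mul_projT.
move=> /mxrankS; rewrite mxrank_ker.
have -> : \rank y^T = 1%N.
  apply/eqP; rewrite eqn_leq rank_leq_row lt0n mxrank_eq0.
  apply/eqP => y0; have /matrixP/(_ 0 0)/eqP := sphere_dot _ y1.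
  by rewrite y0 mul0mx !mxE eqxx eq_sym oner_eq0.
by rewrite subn_gt0 ltnS.
Qed.

(** Tangent preimages of the standard basis vectors are fixed by [projT y], hence form the columns
    of a right inverse. *)
Lemma DFsurj_row_free H y : DFsurj H y -> row_free (jac H y *m projT y).
Proof.
move=> surj; apply/row_freeP.
have /choice[f fP] (j : 'I_(size H)) : exists u : 'cV[R]_n.+1,
    y^T *m u = 0 /\ jac H y *m u = delta_mx j 0 by exact: surj.
exists (\matrix_(i, j) f j i 0); apply/matrixP => i j.
have [yf Jf] := fP j.
have -> : (jac H y *m projT y *m (\matrix_(i, j) f j i 0)) i j =
          (jac H y *m projT y *m f j) i 0.
  by rewrite [LHS]mxE [RHS]mxE; apply: eq_bigr => k _; congr (_ * _); rewrite mxE.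
by rewrite -mulmxA projT_tangent// Jf !mxE eqxx andbT.
Qed.

Lemma DFsurj_size H y : sphere y -> DFsurj H y -> (size H <= n)%N.
Proof.
move=> y1 /DFsurj_row_free; rewrite /row_free => /eqP <-.
exact: leq_trans (mxrankM_maxr _ _) (rank_projT _ y1).
Qed.

Lemma pinvT_tangent H y : sphere y -> projT y *m pinvT H y = pinvT H y.
Proof.
move=> y1; rewrite /pinvT !mulmxA; congr (_ *m _).
by rewrite trmx_mul trmx_projT mulmxA projT_idem.
Qed.

Lemma jac_pinvT H y : sphere y -> DFsurj H y -> jac H y *m pinvT H y = 1%:M.
Proof.
move=> y1 /DFsurj_row_free Mf.
rewrite -(pinvT_tangent _ _ y1) mulmxA /pinvT mulmxA mulmxV//.
exact: gram_unitmx.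
Qed.

Lemma tr_mul_pinvT H y : sphere y -> y^T *m pinvT H y = 0.
Proof. by move=> y1; rewrite -(pinvT_tangent _ _ y1) mulmxA tr_mul_projT// mul0mx. Qed.

Lemma tnormE H : tnorm H = Num.sqrt (\sum_(i < size H) wnorm2 (nthp H i)).
Proof. by rewrite /tnorm (big_nth (hpoly0 R n)) big_mkord. Qed.

Lemma sqr_tnorm H : tnorm H ^+ 2 = \sum_(i < size H) wnorm2 (nthp H i).
Proof. by rewrite tnormE sqr_sqrtr// sumr_ge0// => i _; exact: wnorm2_ge0. Qed.

Lemma tnorm_ge0 H : 0 <= tnorm H.
Proof. exact: sqrtr_ge0. Qed.

Lemma opnorm_ge0 {m k} (B : 'M[R]_(m, k)) : 0 <= opnorm B.
Proof.
have [[v v1]|none] := pselect (exists v : 'cV[R]_k, vnorm v = 1).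
  exact: le_trans (vnorm_ge0 _) (opnorm_unit B _ v1).
(* Without unit vectors (zero columns) the set is empty, and its [sup] is 0 by convention. *)
rewrite /opnorm (_ : [set _ | _ in _] = set0) ?sup0//.
by apply/seteqP; split => // _ [v /= v1 _]; apply: none; exists v.
Qed.

Lemma vnorm_teval_le H y (t : R) : 0 <= t ->
  (forall i : 'I_(size H), `|heval (nthp H i) y| <= t * wnorm (nthp H i)) ->
  vnorm (tevalF H y) <= t * tnorm H.
Proof.
move=> t0 Ht; rewrite -ler_sqr ?nnegrE ?mulr_ge0 ?vnorm_ge0 ?tnorm_ge0//.
rewrite sqr_vnorm exprMn sqr_tnorm mulr_sumr; apply: ler_sum => i _.
rewrite mxE -[leLHS]real_normK ?num_real//.
rewrite -(sqr_sqrtr (wnorm2_ge0 _)) -exprMn ler_sqr ?nnegrE ?mulr_ge0 ?sqrtr_ge0//.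
Qed.

Lemma kappa_xE_nonsurj H y : tnorm H != 0 -> ~ DFsurj H y ->
  kappa_x H y = einv ((vnorm (tevalF H y) / tnorm H)%:E).
Proof.
move=> H0 nsurj; rewrite /kappa_x (negPf H0) /mu_proj asboolF//.
rewrite mulyy /= add0r.
by rewrite -expr_div_n sqrtr_sqr ger0_norm// divr_ge0 ?vnorm_ge0 ?tnorm_ge0.
Qed.

(** The case [m = 0] is kept apart because [einv] sends 0 to [+oo]. *)
Lemma kappa_xE_surj H y (m : R) : tnorm H != 0 -> DFsurj H y ->
  m = tnorm H * opnorm (pinvT H y *m Delta H) -> m != 0 ->
  kappa_x H y = einv ((Num.sqrt (m ^- 2 + (vnorm (tevalF H y) / tnorm H) ^+ 2))%:E).
Proof.
move=> H0 surj mE m0; rewrite /kappa_x (negPf H0) /mu_proj asboolT// -mE.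
by rewrite -EFinM /= mulf_eq0 orbb (negPf m0) /= expr_div_n expr2.
Qed.

Lemma einv_ge (t c : R) : 0 < c -> 0 <= t -> t <= c -> ((c^-1)%:E <= einv t%:E)%E.
Proof.
move=> c0 t0 tc; rewrite /=; case: eqP => [_|/eqP tn0]; first exact: leey.
by rewrite lee_fin lef_pV2// posrE lt_def tn0.
Qed.

Lemma einv_le (t c : R) : 0 < c -> 0 <= t -> (einv t%:E <= c%:E)%E -> c^-1 <= t.
Proof.
move=> c0 t0; rewrite /=; case: eqP => [_|/eqP tn0]; first by rewrite leye_eq.
by rewrite lee_fin => tc; rewrite invf_ple ?posrE// lt_def tn0.
Qed.

(** With [w] the relative size of the values of [H] at [y], the bound on [kappa_x] reads
    $m^{-2}+w^2\geq k^{-2}$. As $w\leq t\leq 1/(6k)$, the term $w^2$ is negligible and [m], the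
    value of [mu_proj], is at most [6 / 5 * k]. The Newton step factors through
    [pinvT H y *m Delta H], whose norm [m] controls. *)
Lemma kappa_x_newton H y (t k : R) : sphere y ->
  (forall i : 'I_(size H), 0 < hdeg (nthp H i))%N ->
  0 <= t -> 0 < k -> k * t <= 1 / 6 ->
  (forall i : 'I_(size H), `|heval (nthp H i) y| <= t * wnorm (nthp H i)) ->
  (kappa_x H y <= k%:E)%E ->
  (size H <= n)%N /\
  exists u : 'cV[R]_n.+1, [/\ \sum_i y i 0 * u i 0 = 0,
    forall i : 'I_(size H), \sum_j hpartial (nthp H i) j y * u j 0 = - heval (nthp H i) y &
    vnorm u <= 6 / 5 * k * t].
Proof.
move=> y1 degH t0 k0 kt Ht kH.
have H0 : tnorm H != 0.
  by apply/eqP => H0; move: kH; rewrite /kappa_x H0 eqxx leye_eq.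
have Hp : 0 < tnorm H by rewrite lt_def H0 tnorm_ge0.
have hle := vnorm_teval_le _ _ _ t0 Ht.
set h := tevalF H y in hle *.
have hH0 : 0 <= vnorm h / tnorm H by rewrite divr_ge0 ?vnorm_ge0 ?tnorm_ge0.
have hH : vnorm h / tnorm H <= t by rewrite ler_pdivrMr.
have k1 : k * k^-1 = 1 by rewrite mulfV// gt_eqF.
have [surj|nsurj] := pselect (DFsurj H y); last first.
  (* Without surjectivity only $w$ remains, so $1/k\leq w\leq t$, against [k * t <= 1 / 6]. *)
  move: kH; rewrite kappa_xE_nonsurj// => /(einv_le _ _ k0 hH0) kh.
  have : k * k^-1 <= k * t by rewrite ler_pM2l// (le_trans kh).
  by rewrite k1; lra.
split; first exact: DFsurj_size surj.
pose m := tnorm H * opnorm (pinvT H y *m Delta H).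
have m0 : 0 <= m by rewrite mulr_ge0 ?tnorm_ge0 ?opnorm_ge0.
have mk : m <= 6 / 5 * k.
  have [->|mn0] := eqVneq m 0; first by rewrite mulr_ge0// ltW.
  move: kH; rewrite (kappa_xE_surj _ _ _ H0 surj erefl mn0) => /(einv_le _ _ k0 (sqrtr_ge0 _)).
  rewrite -/m -/h; set w := vnorm h / tnorm H in hH0 hH *.
  have mV : 0 < m^-1 by rewrite invr_gt0 lt_def mn0.
  have kV : 0 < k^-1 by rewrite invr_gt0.
  rewrite -[X in X <= _ -> _](ger0_norm (ltW kV)) -sqrtr_sqr ler_sqrt; last first.
    by rewrite addr_ge0 ?sqr_ge0// -exprVn sqr_ge0.
  rewrite -exprVn => kmw.
  have wk : w <= k^-1 / 6.
    have : k * w <= 1 / 6 by apply: le_trans kt; rewrite ler_pM2l.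
    by rewrite -(ler_pM2l kV) mulrA mulVf ?gt_eqF// mul1r; lra.
  have w2 : w ^+ 2 <= (k^-1 / 6) ^+ 2 by rewrite ler_sqr ?nnegrE//; lra.
  (* Removing $w^2\leq k^{-2}/36$ leaves at least $\frac{35}{36}k^{-2}$, more than the required
     $\frac{25}{36}k^{-2}$. *)
  have : (5 / 6 * k^-1) ^+ 2 <= m^-1 ^+ 2.
    move: w2 kmw; rewrite !exprMn; set a := k^-1 ^+ 2; set b := m^-1 ^+ 2.
    have : 0 <= a by exact: sqr_ge0.
    rewrite -[X in _ -> _ <= X -> _]mulr1; lra.
  rewrite ler_sqr ?nnegrE; [|by rewrite mulr_ge0// ltW|exact: ltW].
  rewrite -(ler_pM2l k0) mulrCA k1 mulr1 -[X in _ <= X]mulr1.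
  have mp : 0 < m by rewrite lt_def mn0.
  rewrite mulr1 -(ler_pM2r mp) -mulrA mulVf// mulr1; lra.
(* The inverse of [Delta H] applied to [h]; it does not increase the norm, since all degrees are at
   least 1. *)
pose v : 'cV[R]_(size H) := \col_i (h i 0 / Num.sqrt (hdeg (nthp H i))%:R).
have d0 (i : 'I_(size H)) : 0 < Num.sqrt (hdeg (nthp H i))%:R :> R.
  by rewrite sqrtr_gt0 ltr0n degH.
have Dv : Delta H *m v = h.
  apply/matrixP => i j; rewrite (ord1 j) /Delta mul_diag_mx !mxE mulrC divfK//.
  by rewrite gt_eqF.
have vh : vnorm v <= vnorm h.
  rewrite vnorm_le; apply: ler_sum => i _; rewrite !mxE exprMn ler_piMr ?sqr_ge0//.
  by rewrite exprVn sqr_sqrtr// invf_le1 ?ler1n ?ltr0n degH.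
exists (- (pinvT H y *m h)); split.
- transitivity ((y^T *m - (pinvT H y *m h)) 0 0).
    by rewrite [RHS]mxE; apply: eq_bigr => i _; rewrite [in RHS]mxE.
  by rewrite mulmxN mulmxA tr_mul_pinvT// mul0mx oppr0 mxE.
- move=> i; transitivity ((jac H y *m - (pinvT H y *m h)) i 0).
    by rewrite [RHS]mxE; apply: eq_bigr => j _; rewrite [in RHS]mxE.
  by rewrite mulmxN mulmxA jac_pinvT// mul1mx !mxE.
- rewrite -scaleN1r vnormZ normrN1 mul1r -Dv mulmxA.
  apply: le_trans (vnorm_mulmx_opnorm _ _) _.
  apply: (@le_trans _ _ (m * t)); last by rewrite ler_wpM2r.
  have -> : m * t = opnorm (pinvT H y *m Delta H) * (t * tnorm H) by rewrite /m; ring.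
  by rewrite ler_wpM2l ?opnorm_ge0// (le_trans vh).
Qed.

Lemma eunit_sphere : sphere (@eunit R n).
Proof.
rewrite /sphere /= (bigD1 ord0)//= big1 ?mxE ?expr1n ?addr0// => i i0.
by rewrite mxE (negPf i0) expr0n.
Qed.

(** Both terms of $\kappa^{-2}$ are at most 1 at [eunit]: the values are bounded by the Weyl norm,
    and [mu_proj] is at least 1. Their sum is then below 4. *)
Lemma kappa_x_eunit_ge H : (forall i : 'I_(size H), 0 < hdeg (nthp H i))%N ->
  ((2^-1)%:E <= kappa_x H (@eunit R n))%E.
Proof.
move=> degH; set e := @eunit R n; have e1 : sphere e := eunit_sphere.
have [H0|H0] := eqVneq (tnorm H) 0.
  by rewrite /kappa_x H0 eqxx leey.
have Hp : 0 < tnorm H by rewrite lt_def H0 tnorm_ge0.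
have hH : (vnorm (tevalF H e) / tnorm H) ^+ 2 <= 1.
  rewrite expr_div_n ler_pdivrMr ?exprn_gt0// mul1r sqr_vnorm sqr_tnorm.
  by apply: ler_sum => i _; rewrite mxE heval_eunit_le.
have hH0 : 0 <= vnorm (tevalF H e) / tnorm H.
  by rewrite divr_ge0 ?vnorm_ge0 ?tnorm_ge0.
have [surj|nsurj] := pselect (DFsurj H e); last first.
  rewrite kappa_xE_nonsurj//; apply: einv_ge => //.
  have : vnorm (tevalF H e) / tnorm H <= 1 by rewrite -(@ler_sqr R) ?nnegrE// expr1n.
  by move/le_trans; apply; rewrite ler1n.
set B := pinvT H e *m Delta H.
(* The image [v] under [B] of a basis vector is tangent, and the derivative of the [i]-th polynomial
   along it is $\sqrt{d_i}$. The derivative bound at [eunit] then forces $1\leq\|v\|^2\|h_i\|^2$,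
   where $h_i$ is that polynomial. *)
have m1 : 1 <= tnorm H * opnorm B.
  have [i _] : exists i : 'I_(size H), true.
    case: (posnP (size H)) => [sH|sH]; last by exists (Ordinal sH).
    by move: H0; rewrite (size0nil sH) /tnorm big_nil sqrtr0 eqxx.
  have dp : 0 < (hdeg (nthp H i))%:R :> R by rewrite ltr0n degH.
  pose w : 'cV[R]_(size H) := delta_mx i 0.
  have w1 : vnorm w = 1.
    rewrite /vnorm (bigD1 i)//= big1 ?mxE ?eqxx ?expr1n ?addr0 ?sqrtr1// => j ji.
    by rewrite mxE (negPf ji) expr0n.
  pose v := B *m w.
  have v0 : v ord0 0 = 0.
    have : (e^T *m v) 0 0 = 0 by rewrite /v (mulmxA _ B) /B (mulmxA _ (pinvT H e)) tr_mul_pinvT// !mul0mx mxE.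
    rewrite mxE (bigD1 ord0)//= big1 ?addr0 => [|j j0]; first by rewrite !mxE mul1r.
    by rewrite !mxE (negPf j0) mul0r.
  have Jv : \sum_j hpartial (nthp H i) j e * v j 0 = Num.sqrt (hdeg (nthp H i))%:R.
    transitivity ((jac H e *m v) i 0).
      by rewrite [RHS]mxE; apply: eq_bigr => j _; rewrite [in RHS]mxE.
    by rewrite /v (mulmxA _ B) /B (mulmxA _ (pinvT H e)) jac_pinvT// mul1mx /Delta mul_diag_mx !mxE !eqxx mulr1.
  have := directional_derivative_eunit_le (nthp H i) _ v0.
  rewrite -/e Jv sqr_sqrtr ?(ltW dp)// -sqr_vnorm -mulrA -[X in X <= _ -> _]mulr1.
  rewrite ler_pM2l// => vw.
  have wi : wnorm2 (nthp H i) <= tnorm H ^+ 2.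
    rewrite sqr_tnorm (bigD1 i)//= lerDl sumr_ge0// => j _; exact: wnorm2_ge0.
  have vB : vnorm v <= opnorm B by exact: opnorm_unit.
  apply: (@le_trans _ _ (tnorm H * vnorm v)); last by rewrite ler_pM2l.
  rewrite -(@ler_sqr R) ?nnegrE ?mulr_ge0 ?vnorm_ge0 ?tnorm_ge0// expr1n.
  apply: le_trans vw _; rewrite exprMn mulrC ler_wpM2r//.
  exact: sqr_ge0.
have m0 : tnorm H * opnorm B != 0 by rewrite gt_eqF// (lt_le_trans _ m1).
rewrite (kappa_xE_surj _ _ _ H0 surj erefl m0) -/B; apply: einv_ge => //.
rewrite -[leRHS]ger0_norm// -sqrtr_sqr ler_sqrt ?sqr_ge0//.
have : (tnorm H * opnorm B) ^- 2 <= 1.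
  by rewrite -exprVn exprn_ile1 ?invr_ge0 ?invf_le1 ?mulr_ge0 ?tnorm_ge0 ?opnorm_ge0 ?(lt_le_trans _ m1).
lra.
Qed.

End ConditionNumber.

(** * The sphere *)

Section SphereGeometry.
Context {R : realType} {n : nat}.
Implicit Types (x y z u : 'cV[R]_n.+1).

Lemma sphere_vnorm y : sphere y <-> vnorm y = 1.
Proof.
split => [y1|y1]; first by rewrite /vnorm y1 sqrtr1.
by rewrite /sphere /= -sqr_vnorm y1 expr1n.
Qed.

Lemma sqr_chord y z : sphere y -> sphere z ->
  vnorm (z - y) ^+ 2 = 2 - 2 * \sum_i y i 0 * z i 0.
Proof.
move=> y1 z1; rewrite sqr_vnorm.
rewrite (eq_bigr (fun i => z i 0 ^+ 2 + y i 0 ^+ 2 - 2 * (y i 0 * z i 0))).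
  by rewrite sumrB big_split/= -mulr_sumr y1 z1.
by move=> i _; rewrite !mxE; ring.
Qed.

(* The chord of an arc [2a] is [2 sin a], and [a cos a <= sin a]. *)
Lemma dS_le_chord y z : sphere y -> sphere z -> vnorm (z - y) <= 1 / 2 ->
  dS y z <= 6 / 5 * vnorm (z - y).
Proof.
move=> y1 z1; have := sqr_chord _ _ y1 z1; rewrite /dS.
set p := \sum_i _; set t := vnorm (z - y) => t2 t1.
have t0 : 0 <= t by exact: vnorm_ge0.
have t4 : t ^+ 2 <= 1 / 4 by nra.
have p1 : -1 <= p <= 1 by have t20 := sqr_ge0 t; apply/andP; split; lra.
set a := acos p / 2.
have -> : acos p = a *+ 2 by rewrite /a -mulr_natr divfK.
have a0 : 0 <= a by rewrite divr_ge0 ?acos_ge0.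
have api : a <= pi / 2 by rewrite ler_pM2r ?acos_lepi ?invr_gt0.
have pi0 := pi_ge0 R.
have cosp : cos (a *+ 2) = p.
  by rewrite /a -mulr_natr divfK// acosK// in_itv.
have ca0 : 0 <= cos a by apply: cos_ge0_pihalf; apply/andP; split; lra.
have sa0 : 0 <= sin a by apply: sin_ge0_pi; apply/andP; split; lra.
have sa : sin a = t / 2.
  apply/eqP; rewrite -(@eqrXn2 _ 2)// ?divr_ge0// expr_div_n t2.
  have := cos2Dsin2 a; have := cos_mulr2n a; rewrite cosp => *; apply/eqP; lra.
(* Here $\sin^2 a=t^2/4\leq 1/16$, so $\cos^2 a\geq 15/16>25/36$. *)
have ca : 5 / 6 <= cos a.
  rewrite -(@ler_sqr R) ?nnegrE//.
  have := cos2Dsin2 a; rewrite sa expr_div_n; lra.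
have [|c /itvP cI E] := @MVT_segment R sin cos 0 a a0 (fun w _ => is_derive_sin w).
  by apply: continuous_subspaceT; exact: continuous_sin.
move: E; rewrite sin0 !subr0 sa => E.
have : cos a * a <= cos c * a.
  have ca' : c <= a by rewrite cI.
  have c0 : 0 <= c by rewrite cI.
  rewrite ler_wpM2r// leNgt ltr_cos ?in_itv/= -?leNgt//; apply/andP; split => //; lra.
have : 5 / 6 * a <= cos a * a by rewrite ler_wpM2r.
rewrite -E -mulr_natr; lra.
Qed.

(** Since [u] is tangent, [y + s *: u] has norm at least 1. Rescaling it to the sphere multiplies
    each value by a factor in $[0,1]$, which preserves upper bounds by a nonnegative [T]. The factor
    [c] carries the sign of a constraint. *)
Lemma retract_sphere y u (s : R) : sphere y -> \sum_i y i 0 * u i 0 = 0 -> 0 <= s ->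
  exists z, [/\ sphere z, vnorm (z - y) <= s * vnorm u &
    forall (h : hpoly R n) (c T : R), 0 <= T ->
      c * heval h (y + s *: u) <= T -> c * heval h z <= T].
Proof.
move=> y1 yu s0; set w := y + s *: u; set rho := vnorm w.
have rho2 : rho ^+ 2 = 1 + s ^+ 2 * vnorm u ^+ 2.
  rewrite !sqr_vnorm mulr_sumr.
  rewrite (eq_bigr (fun i => y i 0 ^+ 2 + s ^+ 2 * u i 0 ^+ 2 + 2 * s * (y i 0 * u i 0))).
    by rewrite !big_split/= -[X in _ + X]mulr_sumr yu mulr0 addr0 y1.
  by move=> i _; rewrite !mxE; ring.
have su0 : 0 <= s ^+ 2 * vnorm u ^+ 2 by rewrite mulr_ge0 ?sqr_ge0.
have rho0 : 0 <= rho by exact: vnorm_ge0.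
have rho1 : 1 <= rho by rewrite -(@ler_sqr R) ?nnegrE// expr1n rho2; lra.
have rhop : 0 < rho by rewrite (lt_le_trans _ rho1).
have z1 : sphere (rho^-1 *: w).
  by apply/sphere_vnorm; rewrite vnormZ gtr0_norm ?invr_gt0// mulVf ?gt_eqF.
have V0 : 0 <= rho^-1 by rewrite invr_ge0.
have V1 : rho^-1 <= 1 by rewrite invf_le1.
exists (rho^-1 *: w); split => //.
- rewrite -(@ler_sqr R) ?nnegrE ?vnorm_ge0 ?mulr_ge0 ?vnorm_ge0//.
  rewrite sqr_chord// exprMn.
  have -> : \sum_i y i 0 * (rho^-1 *: w) i 0 = rho^-1.
    rewrite (eq_bigr (fun i => rho^-1 * (y i 0 ^+ 2) + rho^-1 * s * (y i 0 * u i 0))).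
      by rewrite big_split/= -!mulr_sumr yu y1 mulr0 addr0 mulr1.
    by move=> i _; rewrite !mxE; ring.
  (* The claim becomes $2-2/\rho\leq\rho^2-1$; after multiplication by $\rho$ the difference is
     $(\rho-1)^2(\rho+2)$. *)
  have -> : s ^+ 2 * vnorm u ^+ 2 = rho ^+ 2 - 1 by rewrite rho2; ring.
  rewrite -(ler_pM2l rhop) mulrBr mulrCA mulfV ?gt_eqF//.
  rewrite -subr_ge0.
  have -> : rho * (rho ^+ 2 - 1) - (rho * 2 - 2 * 1) = (rho - 1) ^+ 2 * (rho + 2) by ring.
  by rewrite mulr_ge0 ?sqr_ge0// addr_ge0.
- move=> h c T T0 cT; rewrite hevalZ mulrCA.
  have q0 : 0 <= rho^-1 ^+ hdeg h by rewrite exprn_ge0.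
  apply: (@le_trans _ _ (rho^-1 ^+ hdeg h * T)); first by rewrite ler_wpM2l.
  by rewrite ler_piMl// exprn_ile1.
Qed.

Lemma trmx_rV_continuous : continuous (fun v : 'rV[R]_n.+1 => v^T : 'cV[R]_n.+1).
Proof.
move=> /= v A /nbhs_ballP[e e0 eA]; apply/nbhs_ballP; exists e => // w [_ vw].
by apply: eA; split => // i j; rewrite !mxE; exact: vw.
Qed.

Lemma continuous_sum_sqr_sub (a : 'cV[R]_n.+1) :
  continuous (fun y : 'cV[R]_n.+1 => \sum_i (y - a) i 0 ^+ 2).
Proof.
apply: (continuous_big (op := +%R)).
  by move=> z; apply: cvgD; [exact: cvg_fst|exact: cvg_snd].
move=> i _ y.
apply: (@continuous_comp _ _ _ (fun M : 'cV[R]_n.+1 => (M - a) i 0) (fun t : R => t ^+ 2)).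
  rewrite (_ : (fun M : 'cV[R]_n.+1 => (M - a) i 0) = (fun M => M i 0 - a i 0)); last first.
    by apply/funext => M; rewrite !mxE.
  by apply: continuousB; [exact: coord_continuous|exact: cst_continuous].
exact: exprn_continuous.
Qed.

(** Heine-Borel is applied to row vectors, and compactness is carried over by the continuous
    transpose. *)
Lemma compact_sphere : compact (@sphere R n).
Proof.
have c0 := continuous_sum_sqr_sub 0.
pose S := [set v : 'rV[R]_n.+1 | sphere v^T].
have -> : @sphere R n = [set v^T | v in S].
  apply/seteqP; split => [y y1|_ [v vS <-]//].
  by exists y^T; rewrite /S /= trmxK.
apply: continuous_compact.
  by apply: continuous_subspaceT; exact: trmx_rV_continuous.
apply: bounded_closed_compact.
  exists 1; split => // M M1 v vS.
  apply: le_trans (ltW M1); rewrite [leLHS]/Num.Def.normr/= mx_normrE.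
  apply: bigmax_le => // -[i j] _ /=; rewrite ord1.
  rewrite -(@ler_sqr R) ?nnegrE// expr1n real_normK ?num_real//.
  rewrite -vS (bigD1 j)//= mxE lerDl sumr_ge0// => k _; exact: sqr_ge0.
have -> : S = (fun v : 'rV[R]_n.+1 => \sum_i (v^T - 0) i 0 ^+ 2) @^-1` [set 1].
  by apply/seteqP; split => v; rewrite /S /sphere /= subr0.
apply: preimage_closed; last exact: closed_eq.
move=> v _; apply: (@continuous_comp _ _ _ (fun v : 'rV[R]_n.+1 => v^T : 'cV[R]_n.+1)
  (fun y => \sum_i (y - 0) i 0 ^+ 2)).
  exact: trmx_rV_continuous.
exact: c0.
Qed.

End SphereGeometry.

(** * Violation of the constraints and its descent *)

Section Violation.
Context {R : realType} {n : nat}.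
Variables (F G : seq (hpoly R n)).
Implicit Types (y u : 'cV[R]_n.+1).

Local Notation nthp := (nth (hpoly0 R n)).

(** The default 0 of the maxima makes satisfied inequalities and empty tuples contribute nothing. *)
Definition violation y : R :=
  Num.max (\big[Num.max/0]_(i < size F) (`|heval (nthp F i) y| / wnorm (nthp F i)))
          (\big[Num.max/0]_(j < size G) (- heval (nthp G j) y / wnorm (nthp G j))).

Lemma violation_ge0 y : 0 <= violation y.
Proof. by rewrite le_max bigmax_ge_id. Qed.

Lemma continuous_violation : continuous violation.
Proof.
have maxc : continuous (fun z : R * R => Num.max z.1 z.2) by exact: max_continuous.
have divc (h : hpoly R n) : continuous (fun y => heval h y / wnorm h).
  by move=> y; apply: continuousM; [exact: continuous_heval|exact: cst_continuous].
have Fc : continuous (fun y =>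
    \big[Num.max/0]_(i < size F) (`|heval (nthp F i) y| / wnorm (nthp F i))).
  apply: (@continuous_big R _ _ _ _ maxc _ _
    (fun (i : 'I_(size F)) y => `|heval (nthp F i) y| / wnorm (nthp F i))) => i _ y.
  apply: (@continuousM _ _ (fun y => `|heval (nthp F i) y|)); last exact: cst_continuous.
  apply: (@continuous_comp _ _ _ (heval (nthp F i)) Num.norm).
    exact: continuous_heval.
  exact: norm_continuous.
have Gc : continuous (fun y =>
    \big[Num.max/0]_(j < size G) (- heval (nthp G j) y / wnorm (nthp G j))).
  apply: (@continuous_big R _ _ _ _ maxc _ _
    (fun (j : 'I_(size G)) y => - heval (nthp G j) y / wnorm (nthp G j))) => i _ y.
  apply: (@continuousM _ _ (fun y => - heval (nthp G i) y)); last exact: cst_continuous.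
  by apply: continuousN; exact: continuous_heval.
by move=> y; apply: continuous_max; [exact: Fc|exact: Gc].
Qed.

Hypothesis wF : forall i : 'I_(size F), 0 < wnorm (nthp F i).
Hypothesis wG : forall j : 'I_(size G), 0 < wnorm (nthp G j).

Lemma violation_leP y (t : R) : 0 <= t ->
  violation y <= t <->
  (forall i : 'I_(size F), `|heval (nthp F i) y| <= t * wnorm (nthp F i)) /\
  (forall j : 'I_(size G), - heval (nthp G j) y <= t * wnorm (nthp G j)).
Proof.
move=> t0; rewrite /violation ge_max; split.
  case/andP => /bigmax_leP[_ Ft] /bigmax_leP[_ Gt]; split => i.
    by rewrite -ler_pdivrMr// Ft.
  by rewrite -ler_pdivrMr// Gt.
by case=> Ft Gt; apply/andP; split; apply/bigmax_leP; split => // i _;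
  rewrite ler_pdivrMr.
Qed.

Lemma violation0_SFG y : sphere y -> violation y <= 0 -> SFG F G y.
Proof.
move=> y1 /(violation_leP _ _ (lexx 0))[Fy Gy]; split => //; split => i.
  by apply/eqP; rewrite -normr_le0 (le_trans (Fy i))// mul0r.
by rewrite -oppr_le0 (le_trans (Gy i))// mul0r.
Qed.

(** If the constraint is attained, Newton's equation makes it decrease at rate [T], up to the error
    [e * T]. Otherwise the gap below [T] absorbs any first-order change once [s] is small. *)
Lemma descent_near (h : hpoly R n) (c T e : R) y u :
  `|c| = 1 -> 0 < T -> 0 < e -> c * heval h y <= T ->
  (c * heval h y = T -> \sum_j hpartial h j y * u j 0 = - heval h y) ->
  \forall s \near (0:R)^'+, c * heval h (y + s *: u) <= (1 - (1 - e) * s) * T.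
Proof.
move=> c1 T0 e0 hT actE; set D := \sum_j _ in actE.
have cn (a b : R) : `|a| <= b -> c * a <= b.
  by move=> ab; apply: le_trans (ler_norm _) _; rewrite normrM c1 mul1r.
have [hTE|hTN] := eqVneq (c * heval h y) T.
  near=> s.
  have s0 : 0 < s by near: s; exact: nbhs_right_gt.
  have : `|heval h (y + s *: u) - heval h y - s * D| <= e * T * s.
    by near: s; apply: heval_directional_derivative; rewrite mulr_gt0.
  move=> /cn; rewrite actE// -hTE; lra.
have gap : 0 < T - c * heval h y by rewrite subr_gt0 lt_neqAle hTN.
(* [|D| + 1] bounds the growth rate of the value, and [T] the rate at which the target falls. *)
have C0 : 0 < `|D| + 1 + T by rewrite addr_gt0// ltr_pwDr.
near=> s.
have s0 : 0 < s by near: s; exact: nbhs_right_gt.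
have : `|heval h (y + s *: u) - heval h y - s * D| <= 1 * s.
  by near: s; apply: heval_directional_derivative.
have : s < (T - c * heval h y) / (`|D| + 1 + T).
  by near: s; apply: nbhs_right_lt; rewrite divr_gt0.
rewrite ltr_pdivlMr// => sgap /cn; rewrite !mulrBr => dir.
have cD : c * (s * D) <= s * `|D|.
  by apply: cn; rewrite normrM gtr0_norm.
have esT : 0 <= e * s * T by rewrite !mulr_ge0// ltW.
lra.
Unshelve. all: by end_near. Qed.

Lemma violation_descent y u : sphere y -> 0 < violation y ->
  \sum_i y i 0 * u i 0 = 0 ->
  (forall i : 'I_(size F),
     \sum_j hpartial (nthp F i) j y * u j 0 = - heval (nthp F i) y) ->
  (forall i : 'I_(size G), - heval (nthp G i) y = violation y * wnorm (nthp G i) ->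
     \sum_j hpartial (nthp G i) j y * u j 0 = - heval (nthp G i) y) ->
  exists s z, [/\ 0 < s, sphere z, vnorm (z - y) <= s * vnorm u &
    violation z <= (1 - 4 / 5 * s) * violation y].
Proof.
move=> y1 t0 yu DF DG; set t := violation y in t0 DG *.
have [Fy Gy] := (violation_leP _ _ (ltW t0)).1 (lexx t).
(* The loss of 1/5 leaves a descent rate of 4/5, above the rate 3/5 at which the distance penalty
   will grow. *)
have e0 : 0 < 5^-1 :> R by rewrite invr_gt0.
have near1 (c : R) : `|c| = 1 -> \forall s \near (0:R)^'+, forall i : 'I_(size F),
    c * heval (nthp F i) (y + s *: u) <= (1 - (1 - 5^-1) * s) * (t * wnorm (nthp F i)).
  move=> c1; apply: filter_forall => i; apply: descent_near => //.
    by rewrite mulr_gt0.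
  by apply: le_trans (Fy i); rewrite (le_trans (ler_norm _))// normrM c1 mul1r.
have nearG : \forall s \near (0:R)^'+, forall i : 'I_(size G),
    -1 * heval (nthp G i) (y + s *: u) <= (1 - (1 - 5^-1) * s) * (t * wnorm (nthp G i)).
  apply: filter_forall => i; apply: descent_near => //.
  - by rewrite normrN1.
  - by rewrite mulr_gt0.
  - by rewrite mulN1r.
  - by rewrite mulN1r; exact: DG.
have [s [s0 s1 sF sF' sG]] : exists s : R, [/\ 0 < s, s < 1,
    forall i : 'I_(size F),
      1 * heval (nthp F i) (y + s *: u) <= (1 - (1 - 5^-1) * s) * (t * wnorm (nthp F i)),
    forall i : 'I_(size F),
      -1 * heval (nthp F i) (y + s *: u) <= (1 - (1 - 5^-1) * s) * (t * wnorm (nthp F i)) &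
    forall i : 'I_(size G),
      -1 * heval (nthp G i) (y + s *: u) <= (1 - (1 - 5^-1) * s) * (t * wnorm (nthp G i))].
  apply: (@filter_ex _ (0:R)^'+); near=> s; split.
  - by near: s; exact: nbhs_right_gt.
  - by near: s; apply: nbhs_right_lt.
  - by near: s; apply: near1; rewrite normr1.
  - by near: s; apply: near1; rewrite normrN1.
  - by near: s.
have [z [z1 zy zT]] := retract_sphere y u s y1 yu (ltW s0).
exists s, z; split => //.
have -> : 4 / 5 = 1 - 5^-1 :> R by lra.
set q := 1 - (1 - 5^-1) * s in sF sF' sG *.
have q0 : 0 <= q by rewrite /q; lra.
have qt (h : hpoly R n) : 0 <= q * (t * wnorm h).
  by rewrite mulr_ge0// mulr_ge0 ?sqrtr_ge0// ltW.
apply/violation_leP; first by rewrite mulr_ge0// ltW.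
split => i; rewrite -mulrA; last first.
  by rewrite -mulN1r; apply: zT.
by rewrite ler_norml lerNl -mulN1r -[X in _ && (X <= _)]mul1r !zT.
Unshelve. all: by end_near. Qed.

End Violation.

(** * Tuples extended by a subset of the inequalities *)

Section AppendedTuple.
Context {R : realType} {n : nat}.
Variables (F G : seq (hpoly R n)) (L : {set 'I_(size G)}).

Local Notation nthp := (nth (hpoly0 R n)).

Lemma size_appendL : size (appendL F L) = (size F + #|L|)%N.
Proof. by rewrite size_cat size_map -cardE. Qed.

Lemma nth_appendL_P (P : hpoly R n -> Prop) :
  (forall i : 'I_(size F), P (nthp F i)) ->
  (forall j, j \in L -> P (nthp G j)) ->
  forall i : 'I_(size (appendL F L)), P (nthp (appendL F L) i).
Proof.
move=> PF PG [i /=]; rewrite size_appendL /appendL nth_cat => il.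
case: ltnP => [iF|Fi]; first exact: (PF (Ordinal iF)).
have iL : (i - size F < size (enum L))%N by rewrite -cardE ltn_subLR.
have [j0 _] : exists j0 : 'I_(size G), true.
  by case: (enum L) iL => // j0 ? _; exists j0.
by rewrite (nth_map j0)//; apply: PG; rewrite -mem_enum mem_nth.
Qed.

Lemma nth_appendL_inv (P : hpoly R n -> Prop) :
  (forall i : 'I_(size (appendL F L)), P (nthp (appendL F L) i)) ->
  (forall i : 'I_(size F), P (nthp F i)) /\ (forall j, j \in L -> P (nthp G j)).
Proof.
move=> PH; split => [i|j jL].
  have iH : (i < size (appendL F L))%N by rewrite size_appendL ltn_addr.
  by have := PH (Ordinal iH); rewrite /= nth_cat ltn_ord.
have jE : (index j (enum L) < #|L|)%N by rewrite cardE index_mem mem_enum.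
have iH : (size F + index j (enum L) < size (appendL F L))%N.
  by rewrite size_appendL ltn_add2l.
have := PH (Ordinal iH); rewrite /= nth_cat ltnNge leq_addr /= addKn.
by rewrite (nth_map j) -?cardE// nth_index ?mem_enum.
Qed.

Lemma kappa_appendL_le_star (y : 'cV[R]_n.+1) : sphere y ->
  (size F + #|L| <= n.+1)%N ->
  (kappa_x (appendL F L) y <= kappa_star F G)%E.
Proof.
move=> y1 FL; apply: (@le_trans _ _ (kappa (appendL F L))).
  by apply: ereal_sup_ubound; exists y.
exact: (le_bigmax_cond _ (fun L => kappa (appendL F L))).
Qed.

End AppendedTuple.

(** Used to cut an oversized set of active inequalities down to a size that [kappa_star] covers. *)
Lemma exists_subset_card {T : finType} (A : {set T}) (m : nat) : (m <= #|A|)%N ->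
  exists2 B : {set T}, B \subset A & #|B| = m.
Proof.
move=> mA; exists [set x in take m (enum A)].
  by apply/fintype.subsetP => x; rewrite inE => /mem_take; rewrite mem_enum.
rewrite cardsE (card_uniqP _) ?take_uniq ?enum_uniq// size_take -cardE.
by case: ltngtP mA.
Qed.

(** * Newton direction and minimisation on the sphere *)

Section Retraction.
Context {R : realType} {n : nat}.
Variables (F G : seq (hpoly R n)) (k : R).

Local Notation nthp := (nth (hpoly0 R n)).

Hypothesis sizeF : (size F <= n.+1)%N.
Hypothesis degF : forall i : 'I_(size F), (0 < hdeg (nthp F i))%N.
Hypothesis degG : forall j : 'I_(size G), (0 < hdeg (nthp G j))%N.
Hypothesis wF : forall i : 'I_(size F), 0 < wnorm (nthp F i).
Hypothesis wG : forall j : 'I_(size G), 0 < wnorm (nthp G j).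
Hypothesis k_gt0 : 0 < k.
Hypothesis kE : kappa_star F G = k%:E.

Lemma newton_direction (y : 'cV[R]_n.+1) : sphere y ->
  let t := violation F G y in k * t <= 1 / 6 ->
  exists u : 'cV[R]_n.+1, [/\ \sum_i y i 0 * u i 0 = 0,
    forall i : 'I_(size F),
      \sum_j hpartial (nthp F i) j y * u j 0 = - heval (nthp F i) y,
    forall i : 'I_(size G), - heval (nthp G i) y = t * wnorm (nthp G i) ->
      \sum_j hpartial (nthp G i) j y * u j 0 = - heval (nthp G i) y &
    vnorm u <= 6 / 5 * k * t].
Proof.
move=> y1 t kt; have t0 : 0 <= t by exact: violation_ge0.
have [Fy _] := (violation_leP _ _ wF wG y _ t0).1 (lexx t).
pose A := [set j : 'I_(size G) | - heval (nthp G j) y == t * wnorm (nthp G j)]%SET.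
have newton (L : {set 'I_(size G)}) : L \subset A -> (size F + #|L| <= n.+1)%N ->
    (size (appendL F L) <= n)%N /\ exists u : 'cV[R]_n.+1,
      [/\ \sum_i y i 0 * u i 0 = 0,
        forall i : 'I_(size (appendL F L)),
          \sum_j hpartial (nthp (appendL F L) i) j y * u j 0 =
          - heval (nthp (appendL F L) i) y &
        vnorm u <= 6 / 5 * k * t].
  move=> /fintype.subsetP LA FL; apply: kappa_x_newton => //.
  - by apply: (nth_appendL_P _ _ _ (fun h => 0 < hdeg h)%N).
  - apply: (nth_appendL_P _ _ _ (fun h => `|heval h y| <= t * wnorm h)) => //.
    move=> j /LA; rewrite inE -normrN => /eqP ->.
    by rewrite ger0_norm// mulr_ge0 ?sqrtr_ge0.
  - by rewrite -kE kappa_appendL_le_star.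
(* Otherwise some [L] inside [A] would give exactly [n.+1] polynomials, a number still covered by
   [kappa_star], although [newton] allows at most [n]. Hence the whole active set is admissible. *)
have FA : (size F + #|A| <= n.+1)%N.
  rewrite leqNgt; apply/negP => nFA.
  have [|L LA Lm] := @exists_subset_card _ A (n.+1 - size F)%N.
    by rewrite leq_subLR ltnW.
  have FL : (size F + #|L| = n.+1)%N by rewrite Lm subnKC.
  have [|+ _] := newton L LA; first by rewrite FL.
  by rewrite size_appendL FL ltnn.
have [_ [u [yu Du un]]] := newton A (subxx _) FA.
have [DF DG] := nth_appendL_inv _ _ _ (fun h =>
  \sum_j hpartial h j y * u j 0 = - heval h y) Du.
by exists u; split => // i /eqP gi; apply: DG; rewrite inE.
Qed.

Lemma nearby_solution (x : 'cV[R]_n.+1) (r : R) : sphere x ->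
  violation F G x <= r -> k * r <= 1 / 6 ->
  exists y, SFG F G y /\ vnorm (y - x) <= 2 * k * r.
Proof.
move=> x1 xr kr.
pose psi y := violation F G y + (2 * k)^-1 * vnorm (y - x).
have psic : continuous psi.
  move=> y; apply: continuousD; first exact: continuous_violation.
  apply: (@continuousM _ _ (fun _ => (2 * k)^-1)); first exact: cst_continuous.
  apply: (@continuous_comp _ _ _ (fun y : 'cV[R]_n.+1 => \sum_i (y - x) i 0 ^+ 2) Num.sqrt).
    exact: continuous_sum_sqr_sub.
  exact: sqrt_continuous.
have [y /[!inE] y1 ymin] := compact_EVT_min (ex_intro _ x x1) compact_sphere
  (continuous_subspaceT psic).
(* Comparison with [x] itself, where the penalty vanishes; this bounds both the violation at [y] and
   the distance to [x]. *)
have xy : psi y <= r.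
  apply: le_trans (ymin x _) _; first by rewrite inE.
  by rewrite /psi subrr vnorm0 mulr0 addr0.
have V0 : 0 < (2 * k)^-1 by rewrite invr_gt0 mulr_gt0.
have yx0 : 0 <= (2 * k)^-1 * vnorm (y - x) by rewrite mulr_ge0 ?vnorm_ge0 ?ltW.
have y0 := violation_ge0 F G y.
exists y; split; last first.
  have : (2 * k)^-1 * vnorm (y - x) <= r by move: xy; rewrite /psi; lra.
  by rewrite ler_pdivrMl// mulr_gt0.
apply: violation0_SFG => //; rewrite leNgt; apply/negP => yp.
have kt : k * violation F G y <= 1 / 6.
  by apply: le_trans kr; rewrite ler_pM2l//; move: xy; rewrite /psi; lra.
have [u [yu DF DG un]] := newton_direction _ y1 kt.
have [s [z [s0 z1 zy zv]]] := violation_descent _ _ wF wG _ _ y1 yp yu DF DG.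
have := ymin z; rewrite inE => /(_ z1); rewrite /psi leNgt => /negP; apply.
have zx : vnorm (z - x) <= vnorm (y - x) + s * vnorm u.
  have -> : z - x = (y - x) + (z - y) by rewrite [RHS]addrC subrKA.
  by apply: le_trans (vnormD _ _) _; rewrite lerD2l.
(* A move of length at most $s\cdot\frac65kt$ costs at most $\frac35st$ in penalty, while the
   violation drops by at least $\frac45st$. *)
have : (2 * k)^-1 * vnorm (z - x) <= (2 * k)^-1 * vnorm (y - x) +
    3 / 5 * (s * violation F G y).
  have -> : 3 / 5 * (s * violation F G y) =
      (2 * k)^-1 * (s * (6 / 5 * k * violation F G y)).
    by field; rewrite gt_eqF.
  rewrite -mulrDr ler_pM2l// (le_trans zx)// lerD2l ler_pM2l//.
have : 0 < s * violation F G y by rewrite mulr_gt0.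
move: zv; rewrite mulrBl mul1r -mulrA; lra.
Qed.

End Retraction.

(** * Lower bound for the condition number, and the inclusion *)

Lemma kappa_star_ge {R : realType} {n : nat} (F G : seq (hpoly R n)) :
  (size F <= n.+1)%N -> (forall i : 'I_(size F), 0 < hdeg (nth (hpoly0 R n) F i))%N ->
  ((2^-1)%:E <= kappa_star F G)%E.
Proof.
move=> Fn degF; apply: le_trans _ (kappa_appendL_le_star F G finset.set0 _ eunit_sphere _).
  apply: kappa_x_eunit_ge; apply: (nth_appendL_P _ _ _ (fun h => 0 < hdeg h)%N) => // j.
  by rewrite inE.
by rewrite cards0 addn0.
Qed.

Theorem theorem4p19 (R : realType) (n : nat) (F G : seq (hpoly R n)) (r : R) :
  (size F <= n.+1)%N ->
  all (fun f => 0 < hdeg f)%N (F ++ G) ->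
  0 < r ->
  (r%:E < einv ((13 * ((maxdeg F G)%:R `^ (3 / 2)))%:E
                 * (kappa_star F G * kappa_star F G)))%E ->
  Approx F G r `<=` USph (SFG F G) (3%:E * kappa_star F G * r%:E)%E.
Proof.
move=> Fn deg r0 rk x [x1 [Fx Gx]].
have D_gt0 : F ++ G = [::] \/ (0 < maxdeg F G)%N.
  rewrite /maxdeg; case: (F ++ G) deg => [|f s] /=; first by left.
  by case/andP => f0 _; right; rewrite big_cons leq_max f0.
move: deg; rewrite all_cat.
move=> /andP[/(all_nthP (hpoly0 R n)) degF /(all_nthP (hpoly0 R n)) degG].
have {}degF (i : 'I_(size F)) : (0 < hdeg (nth (hpoly0 R n) F i))%N by exact: degF.
have {}degG (j : 'I_(size G)) : (0 < hdeg (nth (hpoly0 R n) G j))%N by exact: degG.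
have kge := kappa_star_ge F G Fn degF.
split => //.
have dist (y : 'cV[R]_n.+1) : SFG F G y ->
    (dSset x (SFG F G) <= (dS x y)%:E)%E.
  by move=> yS; apply: ereal_inf_lbound; exists y.
(* With both tuples empty [maxdeg] is 0, so this case is separate: [x] itself is a solution, at
   distance 0. *)
have [FG|D0] := D_gt0.
  have /eqP : (size F + size G)%N = 0%N by rewrite -size_cat FG.
  rewrite addn_eq0 => /andP[/eqP F0 /eqP G0].
  apply: le_lt_trans (dist x _) _.
    by split => //; split => -[i]; rewrite ?F0 ?G0.
  have -> : dS x x = 0.
    rewrite /dS (eq_bigr (fun i => x i 0 ^+ 2)) => [|i _]; last by rewrite expr2.
    by rewrite x1 acos1.
  have k0 : (0 < kappa_star F G)%E by rewrite (lt_le_trans _ kge)// lte_fin invr_gt0.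
  by rewrite !mule_gt0 ?lte_fin.
have D1 : 1 <= (maxdeg F G)%:R `^ (3 / 2) :> R.
  rewrite -[leLHS](powRr0 (maxdeg F G)%:R); apply: ler_powR; last by lra.
  by rewrite ler1n.
have d0 : 0 < 13 * (maxdeg F G)%:R `^ (3 / 2) :> R by lra.
(* The value [-oo] contradicts [kge]; for [+oo] the bound on [r] is [einv +oo], that is 0, against
   [r0]. *)
case kE : (kappa_star F G) kge rk => [k||] // kge rk; last first.
  by move: rk; rewrite mulyy gt0_muley ?lte_fin//= ltNge ltW.
have {}kge : 2^-1 <= k by rewrite -lee_fin.
have k0 : 0 < k by rewrite (lt_le_trans _ kge).
have kr13 : 13 * k ^+ 2 * r < 1.
  have X0 : 0 < 13 * (maxdeg F G)%:R `^ (3 / 2) * (k * k).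
    by rewrite mulr_gt0// mulr_gt0.
  move: rk; rewrite -!EFinM /= gt_eqF// lte_fin -(ltr_pM2r X0) mulVf ?gt_eqF//.
  apply: le_lt_trans; rewrite [leRHS]mulrC ler_pM2r// -expr2.
  by rewrite ler_wpM2r ?sqr_ge0//; lra.
(* Since [k] is at least 1/2, $kr\leq 2k^2r<2/13$, which is below 1/6. *)
have kr : k * r <= 2 / 13 by nra.
have wF (i : 'I_(size F)) : 0 < wnorm (nth (hpoly0 R n) F i).
  by have := le_lt_trans (normr_ge0 _) (Fx i); rewrite pmulr_lgt0.
(* A polynomial of norm 0 vanishes at [x] by Cauchy-Schwarz, which the strict inequality in [Approx]
   excludes. *)
have wG (j : 'I_(size G)) : 0 < wnorm (nth (hpoly0 R n) G j).
  rewrite lt_def sqrtr_ge0 andbT; apply/eqP => w0.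
  have := Gx j; rewrite w0 mul0r oppr0 ltNge => /negP; apply.
  have := weighted_cauchy_schwarz _ _ _ (lexx (\sum_a multinom R a *
    (\prod_i x i 0 ^+ val (a : mono n (hdeg (nth (hpoly0 R n) G j))) i) ^+ 2)).
  rewrite -(sqr_sqrtr (wnorm2_ge0 _)) -/(wnorm _) w0 expr0n mulr0 -/(heval _ _).
  by rewrite exprn_even_le0//= => /eqP ->.
have xr : violation F G x <= r.
  apply/violation_leP => //; first exact: ltW.
  split => i; first by rewrite mulrC ltW.
  by rewrite lerNl mulrC ltW.
have kr6 : k * r <= 1 / 6 by lra.
have [y [yS yx]] := nearby_solution F G k Fn degF degG wF wG k0 kE x r x1 xr kr6.
apply: le_lt_trans (dist y yS) _; rewrite -!EFinM lte_fin.
(* The chord is at most $2kr\leq 4/13<1/2$, and the arc at most $\frac65\cdot2kr<3kr$. *)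
have : dS x y <= 6 / 5 * vnorm (y - x).
  by apply: dS_le_chord => //; [case: yS|move: yx; rewrite -mulrA; lra].
have : 0 < k * r by rewrite mulr_gt0.
move: yx; rewrite -!mulrA; lra.
Qed.
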